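(* Let $r\geq 2$ be an integer and let $f_r(x)=\sum_{n=0}^\infty r^{-n}\phi(r^n x)$, where $\phi(x)=\operatorname{dist}(x,\mathbb{Z})$. Then the occupation measure $\mu_{f_r}$ of $f_r$, defined by $$\mu_{f_r}(A):=\lambda\{x\in[0,1): f_r(x)\in A\}$$ for Borel sets $A\subset\mathbb{R}$, is singular with respect to Lebesgue measure $\lambda$ on $\mathbb{R}$.
   Context: $\phi(x)=\operatorname{dist}(x,\mathbb{Z})$ is the distance from the real number $x$ to the nearest integer. $\lambda$ denotes Lebesgue measure on $\mathbb{R}$. *)

(* Defs.v *)
From HB Require Import structures.
From mathcomp Require Import all_boot all_order all_algebra.
From mathcomp Require Import all_classical all_reals all_analysis.
From mathcomp Require Import measurable_realfun lra.

Set Implicit Arguments.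
Unset Strict Implicit.
Unset Printing Implicit Defensive.

Import Order.TTheory GRing.Theory Num.Theory.
Import numFieldNormedType.Exports.

Local Open Scope classical_set_scope.
Local Open Scope ring_scope.

Definition dist_int (R : realType) (x : R) : R :=
  inf [set `|x - k%:~R| | k in [set: int]].

Definition takagi_term (R : realType) (r : nat) (x : R) (n : nat) : R :=
  r%:R ^- n * dist_int (r%:R ^+ n * x).

(* [limn] is total; [cvg_takagi] below shows that the series converges when
   [1 < r]. *)
Definition takagi (R : realType) (r : nat) (x : R) : R :=
  limn (series (takagi_term r x)).

Definition occupation_measure (R : realType) (f : R -> R)
    (A : set (measurableTypeR R)) : \bar R :=
  lebesgue_measure (`[0, 1[ `&` f @^-1` A).

(* Stated for set functions, like [null_dominates]; the definition is meant for
   measures. *)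
Definition mutually_singular d (T : measurableType d) (R : realType)
    (mu nu : set T -> \bar R) : Prop :=
  exists N : set T, [/\ measurable N, mu N = 0%E & nu (~` N) = 0%E].

Section well_definedness.
Context (R : realType).
Implicit Types (x y : R) (r : nat).

Let dist_int_has_inf x : has_inf [set `|x - k%:~R| | k in [set: int]].
Proof.
split; first by exists `|x - 0%:~R|, 0.
by exists 0 => _ [k _ <-].
Qed.

Let dist_int_ge0 x : 0 <= dist_int x.
Proof.
apply: lb_le_inf; first exact: (dist_int_has_inf x).1.
by move=> _ [k _ <-].
Qed.

Let dist_int_le x (k : int) : dist_int x <= `|x - k%:~R|.
Proof. by apply: ge_inf; [exact: (dist_int_has_inf x).2|exists k]. Qed.

Let dist_int_le1 x : dist_int x <= 1.
Proof.
apply: le_trans (dist_int_le x (Num.floor x)) _.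
have /andP[h1 h2] := mem_rg1_floor x; rewrite ger0_norm; lra.
Qed.

Let dist_int_lip x y : dist_int x <= `|x - y| + dist_int y.
Proof.
rewrite -lerBlDl; apply: lb_le_inf; first exact: (dist_int_has_inf y).1.
move=> _ [k _ <-]; rewrite lerBlDl (le_trans (dist_int_le x k))//.
by rewrite (le_trans _ (ler_normD _ _))// addrA subrK.
Qed.

Lemma continuous_dist_int : continuous (@dist_int R).
Proof.
move=> x; apply/cvgrPdist_le => e e0; near=> y.
have xy : `|x - y| <= e by near: y; exact: cvgr_dist_le.
have := dist_int_lip x y; have := dist_int_lip y x.
rewrite (distrC y x) => ? ?; rewrite ler_norml; apply/andP; split; lra.
Unshelve. all: by end_near.
Qed.

Lemma cvg_takagi r x : (1 < r)%N -> cvgn (series (takagi_term r x)).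
Proof.
move=> r1; have rgt1 : 1 < r%:R :> R by rewrite ltr1n.
apply: (@series_le_cvg _ _ (geometric 1 (r%:R^-1))).
- by move=> n; rewrite /takagi_term mulr_ge0// invr_ge0 exprn_ge0.
- by move=> n; rewrite /geometric/= mul1r exprn_ge0.
- move=> n; rewrite /takagi_term /geometric/= mul1r exprVn ler_piMr//.
- apply: is_cvg_geometric_series.
  by rewrite ger0_norm ?invr_ge0// invf_lt1// (lt_trans _ rgt1).
Qed.

Lemma measurable_takagi r : (1 < r)%N ->
  measurable_fun [set: measurableTypeR R] (takagi r : R -> measurableTypeR R).
Proof.
move=> r1.
apply: (measurable_fun_cvg
  (h := fun n x => series (takagi_term r x) n)); last first.
  by move=> x _; exact: cvg_takagi.
move=> n; rewrite /series/=; apply: measurable_sum => i.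
apply: measurable_funM => //.
apply: (measurableT_comp (f := @dist_int R)); last exact: measurable_funM.
apply: continuous_measurable_fun; exact: continuous_dist_int.
Qed.

End well_definedness.

Section occupation_measure_measure.
Context (R : realType) (f : R -> R).
Hypothesis mf :
  measurable_fun [set: measurableTypeR R] (f : _ -> measurableTypeR R).

Let m01 : measurable (`[0, 1[ : set (measurableTypeR R)).
Proof. exact: measurable_itv. Qed.

Let restr : {measure set (measurableTypeR R) -> \bar R} :=
  mrestr lebesgue_measure m01.

Let occupationE : occupation_measure f =
  pushforward restr (f : measurableTypeR R -> measurableTypeR R).
Proof. by apply/funext => A; rewrite /occupation_measure setIC. Qed.

Let occupation0 : occupation_measure f set0 = 0%E.
Proof. by rewrite occupationE measure0. Qed.

Let occupation_ge0 A : (0 <= occupation_measure f A)%E.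
Proof. by rewrite occupationE measure_ge0. Qed.

Let occupation_sigma_additive : semi_sigma_additive (occupation_measure f).
Proof.
by rewrite occupationE; exact: (@measure_semi_sigma_additive _ _ _
  (pushforward restr (f : measurableTypeR R -> measurableTypeR R))).
Qed.

HB.instance Definition _ := isMeasure.Build _ _ _ (occupation_measure f)
  occupation0 occupation_ge0 occupation_sigma_additive.

End occupation_measure_measure.

(* Main.v *)
Require Import Defs.
From mathcomp Require Import all_boot all_order all_algebra.
From mathcomp Require Import all_classical all_reals all_analysis.
From mathcomp Require Import measurable_realfun ring lra.

(* For g on [0, 1] and a weight w >= 0, let cost w g be the infimum over
   measurable sets U of the measure of {x in [0, 1] | g x \notin U} plus w times
   the measure of U; if cost 1 g = 0 then, by Borel-Cantelli, g sends almost
   every point into a null set.  Write T for the function f_r.  Up to affine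
   maps, the restrictions of T to r-adic subintervals of the half periods are
   v |-> h v + 2 T ((k + v) / 2), where h is an integer slope and only the parity
   of k matters.  Cutting an interval into r pieces shows that the costs of these
   functions form a bounded subharmonic function of (h, k) for a persistent
   random walk on the integers, so they are all equal to a constant c(w).  At
   h = k = 1 the first term of the series cancels the slope, and the remaining
   function runs r times over the same range, scaled by 1/r: hence
   c(w) <= c(w / r), and iterating, c(w) <= 4 w / r^n for all n. *)

Set Implicit Arguments.
Unset Strict Implicit.
Unset Printing Implicit Defensive.

Import Order.TTheory GRing.Theory Num.Theory.
Import numFieldNormedType.Exports.

Local Open Scope classical_set_scope.
Local Open Scope ring_scope.

(** * Lebesgue measure under affine maps *)

Section affine.
Context (R : realType).
Local Notation mu := (@lebesgue_measure R).
Local Notation MR := (measurableTypeR R).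

Lemma measurable_affine (a b : R) :
  measurable_fun [set: MR] ((fun x => a * x + b) : MR -> MR).
Proof. by apply: measurable_funD => //; exact: measurable_funM. Qed.

Lemma measurable_affine_preimage (a b : R) (A : set MR) : measurable A ->
  measurable ((fun x : MR => a * x + b : MR) @^-1` A).
Proof.
by move=> mA; rewrite -[_ @^-1` _]setTI; exact: measurable_affine.
Qed.

(** Scaled by [a], the pushforward of [mu] under the map gives half-open intervals their length, so
    it is [mu] by uniqueness. *)
Lemma lebesgue_measure_affine (a b : R) (A : set MR) : 0 < a -> measurable A ->
  mu ((fun x : R => a * x + b) @^-1` A) = (a^-1%:E * mu A)%E.
Proof.
move=> a0 mA.
have an0 : a != 0 by rewrite gt_eqF.
pose T : {measure set MR -> \bar R} :=
  pushforward mu ((fun x => a * x + b) : MR -> MR).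
pose S : {measure set MR -> \bar R} :=
  mscale (NngNum (ltW a0)) (T (measurable_affine a b)).
suff -> : mu A = S A.
  by rewrite /S /mscale/= /T /pushforward muleA -EFinM mulVf// mul1e.
apply: lebesgue_measure_unique => // X /ocitvP[->|[[x y]/= xy ->]].
  by rewrite !measure0.
rewrite /S /mscale/= /T /pushforward.
rewrite (_ : _ @^-1` _ = `](x - b) / a, (y - b) / a]%classic); last first.
  apply/seteqP; split=> z /=; rewrite !in_itv/= ltr_pdivrMr// ler_pdivlMr//;
    rewrite ltrBlDr lerBrDr mulrC//.
rewrite !lebesgue_measure_itv/= !lte_fin xy.
rewrite ltr_pM2r ?invr_gt0// ltrD2r xy -!EFinB -EFinM; congr EFin.
by field.
Qed.

End affine.

(** * Bounded subharmonic functions of a persistent random walk *)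

Section harmonic.
Context (R : realType).

Lemma no_linear_growth (f : nat -> R) (e : R) : 0 < e ->
  (forall n, f n + e <= f n.+1) -> (forall n, `|f n| <= 1) -> False.
Proof.
move=> e0 fS fb.
have fn n : f 0%N + e *+ n <= f n.
  elim: n => [|n IH]; first by rewrite mulr0n addr0.
  by rewrite mulrSr addrA (le_trans _ (fS n))// lerD2r.
have [n hn] : exists n : nat, 2 < e *+ n.
  exists (Num.bound (2 / e)); rewrite -[e *+ _]mulr_natr mulrC -ltr_pdivrMr//.
  by apply: archi_boundP; rewrite divr_ge0// ltW.
have := fn n; have := fb n; have := fb 0%N.
by rewrite !ler_norml => /andP[? ?] /andP[? ?]; lra.
Qed.

Variables (a b : R).
Hypotheses (a0 : 0 < a) (b0 : 0 < b) (ab : a + b = 1).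

(** [A] and [B] are the values for a walker heading right and left; it makes one step, then turns
    with probability [b]. *)
Lemma bounded_subharmonic (A B : int -> R) :
  (forall h, `|A h| <= 1) -> (forall h, `|B h| <= 1) ->
  (forall h, A h <= a * A (h + 1) + b * B (h + 1)) ->
  (forall h, B h <= b * A (h - 1) + a * B (h - 1)) ->
  forall h, A h = A 0 /\ B h = A 0.
Proof.
move=> Ab Bb HA HB.
(* Adding the two inequalities shows that e is nondecreasing.  A positive value
   of e would make A grow linearly at +oo, a negative one B at -oo. *)
pose e h := A h - B (h + 1).
have ae : a = 1 - b by rewrite -ab addrK.
have HB' h : B (h + 1) <= b * A h + a * B h by have := HB (h + 1); rewrite addrK.
have eS h : e h <= e (h + 1).
  rewrite /e; have := HA h; have := HB' (h + 1); rewrite ae; lra.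
have eSn h (n : nat) : e h <= e (h + n%:Z).
  elim: n => [|n IH]; first by rewrite addr0.
  by rewrite (le_trans IH)// (le_trans (eS _))// -addrA -PoszD addn1.
have incA h : b * e h <= a * (A (h + 1) - A h).
  by have := HA h; rewrite /e ae; nra.
have incB h : - (b * e h) <= a * (B h - B (h + 1)).
  by have := HB' h; rewrite /e ae; nra.
have e_le0 h : e h <= 0.
  rewrite leNgt; apply/negP => eh.
  apply: (@no_linear_growth (fun n => A (h + n%:Z)) (b * e h / a)) => //.
    by rewrite divr_gt0// mulr_gt0.
  move=> n; rewrite -lerBrDl ler_pdivrMr// (mulrC _ a) -(addn1 n) PoszD addrA.
  by rewrite (le_trans _ (incA _))// ler_pM2l.
have e_ge0 h : 0 <= e h.
  rewrite leNgt; apply/negP => eh.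
  apply: (@no_linear_growth (fun n => B (h + 1 - n%:Z)) (- (b * e h) / a)) => //.
    by rewrite divr_gt0// oppr_gt0 pmulr_rlt0.
  move=> n; rewrite -lerBrDl ler_pdivrMr// (mulrC _ a).
  have := incB (h - n%:Z).
  have -> : h + 1 - n.+1%:Z = h - n%:Z by rewrite -addn1 PoszD; ring.
  have -> : h + 1 - n%:Z = h - n%:Z + 1 by ring.
  apply: le_trans; rewrite lerN2 ler_pM2l//.
  by have := eSn (h - n%:Z) n; rewrite subrK.
have e0 h : e h = 0 by apply/le_anti; rewrite e_le0 e_ge0.
have BA h : B (h + 1) = A h by have := e0 h; rewrite /e; lra.
(* With [e = 0], [incA] makes [A] nondecreasing and [incB] makes [B] nonincreasing; since [B] is a
   shift of [A], both are constant. *)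
have AS h : A (h + 1) = A h.
  apply/le_anti/andP; split.
    have := incB (h + 1); rewrite e0 !BA mulr0 oppr0 pmulr_rge0// subr_ge0//.
  by have := incA h; rewrite e0 mulr0 pmulr_rge0// subr_ge0.
have A0 h : A h = A 0.
  elim/int_ind : h => // n IH.
    by rewrite -IH -(AS n) -PoszD addn1.
  by rewrite -IH -(AS (- n.+1%:Z)) -(addn1 n) PoszD opprD addrNK.
by move=> h; split; [exact: A0|rewrite -(A0 (h - 1)) -BA subrK].
Qed.

End harmonic.

(** * The distance to the nearest integer *)

Section dist_int.
Context (R : realType).
Implicit Types x : R.

Lemma dist_int_ge0 x : 0 <= dist_int x.
Proof.
apply: lb_le_inf; first by exists `|x - 0%:~R|, 0.
by move=> _ [k _ <-].
Qed.

Lemma dist_int_le x (k : int) : dist_int x <= `|x - k%:~R|.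
Proof. by apply: ge_inf; [exists 0 => _ [? _ <-]|exists k]. Qed.

Lemma dist_intDz x (k : int) : dist_int (x + k%:~R) = dist_int x.
Proof.
rewrite /dist_int; congr inf; apply/seteqP; split=> _ [j _ <-].
  by exists (j - k) => //; rewrite intrB; congr `|_|; ring.
by exists (j + k) => //; rewrite intrD; congr `|_|; ring.
Qed.

Lemma dist_intN x : dist_int (- x) = dist_int x.
Proof.
rewrite /dist_int; congr inf; apply/seteqP; split=> _ [j _ <-];
by exists (- j) => //; rewrite intrN -normrN; congr `|_|; ring.
Qed.

Lemma dist_int_id x : 0 <= x <= 2^-1 -> dist_int x = x.
Proof.
move=> /andP[x0 x2]; apply/le_anti/andP; split.
  by rewrite (le_trans (dist_int_le x 0))// subr0 ger0_norm.
apply: lb_le_inf; first by exists `|x - 0%:~R|, 0.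
move=> _ [k _ <-]; have [k0|k0] := leP k 0.
  have : k%:~R <= 0 :> R by rewrite lerz0.
  by move=> ?; rewrite ger0_norm; lra.
have : 1 <= k%:~R :> R by rewrite -[1]/(1%:~R) ler_int -gtz0_ge1.
by move=> ?; rewrite ler0_norm; lra.
Qed.

End dist_int.

(** * Functional equation, symmetries and bounds of [takagi] *)

Section takagi.
Context (R : realType) (r : nat) (r1 : (1 < r)%N).
Local Notation T := (@takagi R r).

Let r_gt0 : 0 < r%:R :> R. Proof. by rewrite ltr0n ltnW. Qed.

Lemma takagi_rec x : T x = dist_int x + r%:R^-1 * T (r%:R * x).
Proof.
have cv y := @cvg_takagi R r y r1.
have : series (takagi_term r x) n.+1 @[n --> \oo] -->
    dist_int x + r%:R^-1 * T (r%:R * x).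
  have -> : (fun n => series (takagi_term r x) n.+1) =
      (fun n => dist_int x + r%:R^-1 * series (takagi_term r (r%:R * x)) n).
    apply/funext => n; rewrite /series/= big_nat_recl//=; congr (_ + _).
      by rewrite /takagi_term !expr0 invr1 !mul1r.
    rewrite mulr_sumr; apply: eq_bigr => i _.
    by rewrite /takagi_term mulrA (mulrA _ r%:R x) -exprSr -invfM -exprS.
  apply: cvgD; first exact: cvg_cst.
  by apply: cvgM; [exact: cvg_cst|exact: cv].
by move=> h; apply: cvg_lim => //; rewrite -(cvg_shiftS (series _)).
Qed.

Lemma takagiDz x (k : int) : T (x + k%:~R) = T x.
Proof.
rewrite /takagi; congr (limn (series _)); apply/funext => n.
rewrite /takagi_term mulrDr; congr (_ * _).
by rewrite -[r%:R]/(r%:Z%:~R) -rmorphXn/= -intrM dist_intDz.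
Qed.

Lemma takagiN x : T (- x) = T x.
Proof.
rewrite /takagi; congr (limn (series _)); apply/funext => n.
by rewrite /takagi_term (mulrN _ x) dist_intN.
Qed.

Lemma takagi_ge0 x : 0 <= T x.
Proof.
apply: limr_ge; first exact: cvg_takagi.
apply: nearW => n; apply: sumr_ge0 => i _.
by rewrite mulr_ge0 ?dist_int_ge0// invr_ge0 exprn_ge0.
Qed.

Lemma takagi_le2 x : T x <= 2.
Proof.
apply: limr_le; first exact: cvg_takagi.
apply: nearW => n.
have d1 y : @dist_int R y <= 1.
  apply: le_trans (dist_int_le y (Num.floor y)) _.
  have /andP[h1 h2] := mem_rg1_floor y; rewrite ger0_norm; lra.
(* The induction carries the geometric tail: the term of index [n] is at most [2^-n], as [r >= 2]
   and [dist_int <= 1]. *)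
suff : series (takagi_term r x) n + 2^-1 ^+ n * 2 <= 2.
  by apply: le_trans; rewrite lerDl mulr_ge0// exprn_ge0.
elim: n => [|n IH]; first by rewrite /series/= big_nil expr0 mul1r add0r.
apply: le_trans IH; rewrite /series/= big_nat_recr//= -addrA lerD2l.
rewrite /takagi_term exprS.
have : r%:R ^- n * dist_int (r%:R ^+ n * x) <= 2^-1 ^+ n.
  rewrite -[leRHS]mulr1 ler_pM ?dist_int_ge0// ?invr_ge0 ?exprn_ge0//.
  by rewrite -exprVn lerXn2r ?nnegrE ?invr_ge0// lef_pV2 ?posrE// ler_nat.
have : 0 <= 2^-1 ^+ n :> R by rewrite exprn_ge0.
lra.
Qed.

End takagi.

(** * The covering cost of a function *)

Section cost.
Context (R : realType).
Local Notation mu := (@lebesgue_measure R).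
Local Notation MR := (measurableTypeR R).
Implicit Types (g : MR -> MR) (U : set MR) (w c : R).

(** The closed interval is invariant under v |-> 1 - v, which [missed_piece0_odd] uses. *)
Definition missed g U : set MR := `[0, 1] `&` g @^-1` (~` U).

(** Quantifying over real upper bounds [c] makes the infimum a real number, although the measures
    are extended reals. *)
Definition coverable w g c : Prop :=
  exists2 U : set MR, measurable U &
    (mu (missed g U) + w%:E * mu U <= c%:E)%E.

Definition cost w g : R := inf [set c | coverable w g c].

Lemma measurable_missed g U : measurable_fun setT g -> measurable U ->
  measurable (missed g U).
Proof.
move=> mg mU; apply: measurableI; first exact: measurable_itv.
by rewrite -[X in measurable X]setTI; apply: mg => //; exact: measurableC.
Qed.

Lemma coverable1 w g : coverable w g 1.
Proof.
exists set0 => //; rewrite measure0 mule0 adde0 /missed setC0 preimage_setT setIT.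
by rewrite lebesgue_measure_itv/= lte_fin ltr01 oppr0 adde0.
Qed.

Lemma coverable_ge0 w g c : 0 <= w -> coverable w g c -> 0 <= c.
Proof.
move=> w0 [U _]; rewrite -lee_fin; apply: le_trans.
by rewrite adde_ge0// mule_ge0.
Qed.

Lemma cost_le w g c : 0 <= w -> coverable w g c -> cost w g <= c.
Proof.
by move=> w0 gc; apply: ge_inf => //; exists 0 => x; exact: coverable_ge0.
Qed.

Lemma cost_ge0 w g : 0 <= w -> 0 <= cost w g.
Proof.
move=> w0; apply: lb_le_inf; first by exists 1; exact: coverable1.
by move=> c; exact: coverable_ge0.
Qed.

Lemma cost_le1 w g : 0 <= w -> cost w g <= 1.
Proof. by move=> w0; apply: cost_le => //; exact: coverable1. Qed.

Lemma costP w g e : 0 <= w -> 0 < e -> coverable w g (cost w g + e).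
Proof.
move=> w0 e0.
have [|c [U mU Uc] ce] := @inf_adherent _ [set c | coverable w g c] _ e0.
  split; first by exists 1; exact: coverable1.
  by exists 0 => c; exact: coverable_ge0.
by exists U => //; rewrite (le_trans Uc)// lee_fin ltW.
Qed.

Lemma unit_interval_pieces (n : nat) (x : R) : (0 < n)%N -> 0 <= x <= 1 ->
  exists2 i : nat, (i < n)%N & 0 <= n%:R * x - i%:R <= 1.
Proof.
(* The endpoint [x = 1] goes to the last piece; elsewhere [i] is the integer part of [n x]. *)
move=> n0 /andP[x0]; rewrite le_eqVlt => /predU1P[->|x1].
  case: n n0 => // n _; exists n => //.
  by rewrite mulr1 -natrB// subSnn ler01 lexx.
have nx0 : 0 <= n%:R * x by rewrite mulr_ge0.
have /andP[h1 h2] := truncn_itv nx0.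
exists (Num.truncn (n%:R * x)).
  by rewrite -(ltr_nat R) (le_lt_trans h1)// gtr_pMr ?ltr0n.
by rewrite subr_ge0 h1/= lerBlDl (le_trans (ltW h2))// -natr1 addrC.
Qed.

(** * Cutting the unit interval into equal pieces *)

Section cutting.
Variables (n : nat) (c : nat -> R) (g : MR -> MR) (G : nat -> MR -> MR).
Hypotheses (n0 : (0 < n)%N) (mg : measurable_fun setT g).
Hypothesis mG : forall i, measurable_fun setT (G i).
Hypothesis gG : forall i (v : R), (i < n)%N -> 0 <= v <= 1 ->
  g ((i%:R + v) / n%:R) = c i + n%:R^-1 * G i v.

Let nR0 : 0 < n%:R :> R. Proof. by rewrite ltr0n. Qed.

(** If [g x] is outside [U] and [x] lies in piece [i], then [G i] sends the rescaled point [n x - i]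
    outside [V i]; undoing the rescaling divides measures by [n]. *)
Lemma missed_pieces (U : set MR) (V : nat -> set MR) :
  measurable U -> (forall i, measurable (V i)) ->
  (forall i y, (i < n)%N -> V i y -> U (c i + n%:R^-1 * y)) ->
  (mu (missed g U) <= n%:R^-1%:E * \sum_(i < n) mu (missed (G i) (V i)))%E.
Proof.
move=> mU mV VU.
pose P i : set MR := (fun x : R => n%:R * x + - i%:R) @^-1` missed (G i) (V i).
have mP i : measurable (P i).
  by apply: measurable_affine_preimage; exact: measurable_missed.
have -> : (n%:R^-1%:E * \sum_(i < n) mu (missed (G i) (V i)) =
    \sum_(i < n) mu (P i))%E.
  rewrite ge0_sume_distrr//; apply: eq_bigr => i _.
  by rewrite lebesgue_measure_affine//; exact: measurable_missed.
apply: content_subadditive => //; first exact: measurable_missed.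
move=> x /= [x01 gx]; rewrite -bigcup_mkord.
have [i ilt iv] := unit_interval_pieces n0 x01.
exists i => //; split => //= Vi; apply: gx.
have := VU _ _ ilt Vi; rewrite -gG// (_ : (_ + _) / _ = x)//.
by field; rewrite gt_eqF.
Qed.

(** Choose a nearly optimal [V i] for each [G i] and let [U] be the union of the sets
    [c i + V i / n]. By subadditivity, both the missed measure and the measure of [U] are at most
    the means over the pieces. *)
Lemma cost_pieces w : 0 <= w ->
  cost w g <= n%:R^-1 * \sum_(i < n) cost w (G i).
Proof.
move=> w0; apply/ler_addgt0Pr => e e0.
have /choice[V hV] : forall i, exists V : set MR, measurable V /\
   (mu (missed (G i) V) + w%:E * mu V <= (cost w (G i) + e)%:E)%E.
  by move=> i; have [V] := costP (G i) w0 e0; exists V.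
have mV i := (hV i).1; have cV i := (hV i).2.
pose Q i : set MR := (fun y : R => n%:R * y + - (n%:R * c i)) @^-1` V i.
have mQ i : measurable (Q i) by exact: measurable_affine_preimage.
pose U : set MR := \big[setU/set0]_(i < n) Q i.
have mU : measurable U by exact: bigsetU_measurable.
have VU i y : (i < n)%N -> V i y -> U (c i + n%:R^-1 * y).
  move=> ilt Vy; rewrite /U -bigcup_mkord; exists i => //.
  suff E : n%:R * (c i + n%:R^-1 * y) + - (n%:R * c i) = y by rewrite /Q /= E.
  by field; rewrite gt_eqF.
have muU : (mu U <= n%:R^-1%:E * \sum_(i < n) mu (V i))%E.
  rewrite ge0_sume_distrr//.
  rewrite (eq_bigr (fun i : 'I_n => mu (Q i))); last first.
    by move=> i _; rewrite lebesgue_measure_affine.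
  exact: content_subadditive.
apply: cost_le => //; exists U => //.
apply: (@le_trans _ _ (n%:R^-1%:E *
    \sum_(i < n) (mu (missed (G i) (V i)) + w%:E * mu (V i)))%E).
  rewrite big_split/= -ge0_sume_distrr// ge0_muleDr//; last 2 first.
  - exact: sume_ge0.
  - by rewrite mule_ge0// sume_ge0.
  rewrite leeD//; first exact: missed_pieces.
  by rewrite muleCA lee_pmul.
have -> : n%:R^-1 * \sum_(i < n) cost w (G i) + e =
    n%:R^-1 * \sum_(i < n) (cost w (G i) + e).
  rewrite big_split/= sumr_const card_ord mulrDr -[e *+ n]mulr_natl.
  by rewrite mulKf// gt_eqF.
rewrite EFinM -sumEFin lee_pmul//; last exact: lee_sum.
by apply: sume_ge0 => i _; rewrite adde_ge0// mule_ge0.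
Qed.

End cutting.

End cost.

Lemma mean_cst (R : realFieldType) (n : nat) (x : \bar R) : (0 < n)%N ->
  (n%:R^-1%:E * \sum_(i < n) x = x)%E.
Proof.
move=> n0; rewrite sumr_const card_ord -[X in (_ * X)%E]/(x *+ n)%E.
rewrite -mule_natl muleA -EFinM.
by rewrite mulVf ?mul1e// pnatr_eq0 -lt0n.
Qed.

(** * From zero cost to singularity *)

Section singular.
Context (R : realType).
Local Notation mu := (@lebesgue_measure R).
Local Notation MR := (measurableTypeR R).

(** Choose [U n] of total cost at most [2^-n]. By Borel-Cantelli, the upper limits of the sets [U n]
    and of the sets they miss are both null; the complement of the first one separates the two
    measures. *)
Lemma cost0_singular (g : MR -> MR) : measurable_fun setT g ->
  cost 1 g = 0 -> mutually_singular (occupation_measure g) mu.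
Proof.
move=> mg g0.
have e0 n : 0 < 2^-1 ^+ n :> R by rewrite exprn_gt0.
have /choice[U hU] : forall n, exists U : set MR, measurable U /\
   (mu (missed g U) + 1%:E * mu U <= (2^-1 ^+ n)%:E)%E.
  by move=> n; have [U] := costP g ler01 (e0 n); rewrite g0 add0r; exists U.
have mU n := (hU n).1.
have summable (F : nat -> set MR) : (forall n, mu (F n) <= (2^-1 ^+ n)%:E)%E ->
    (\big[+%E/0%R]_(0 <= n <oo) mu (F n) < +oo)%E.
  move=> F2; apply: (@le_lt_trans _ _
      (\big[+%E/0%R]_(0 <= n <oo) (geometric 1 (2^-1 : R) n)%:E)%E).
    apply: lee_nneseries => [n _ _|n _]; first exact: measure_ge0.
    by rewrite /geometric/= mul1r.
  have cg : cvgn (series (geometric 1 (2^-1 : R))).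
    by apply: is_cvg_geometric_series; rewrite ger0_norm; lra.
  under eq_fun do rewrite sumEFin.
  by rewrite EFin_lim// ltry.
have mL (F : nat -> set MR) : (forall n, measurable (F n)) ->
    measurable (lim_sup_set F).
  move=> mF; apply: bigcap_measurable => // n _.
  by apply: bigcup_measurable => k _.
exists (~` lim_sup_set U); split.
- by apply: measurableC; exact: mL.
- have mM n : measurable (missed g (U n)) by exact: measurable_missed.
  have mN : measurable ((g : MR -> MR) @^-1` (~` lim_sup_set U)).
    rewrite -[X in measurable X]setTI; apply: mg => //.
    by apply: measurableC; exact: mL.
  apply/eqP; rewrite -measure_le0.
  rewrite -(@lim_sup_set_cvg0 _ _ _ mu (fun n => missed g (U n))) => //.
    apply: le_measure; rewrite ?inE.
    + by apply: measurableI => //; exact: measurable_itv.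
    + exact: mL.
    (* If [g x] is outside the upper limit, it avoids all [U k] with [k >= m], so [x] is missed by
       infinitely many of them. *)
    + move=> x [/= x01 gx] n _.
      have /existsNP[m /not_implyP[_ gm]] := gx.
      exists (maxn m n); first exact: leq_maxr.
      split => /=; last first.
        by move=> Ux; apply: gm; exists (maxn m n) => //; exact: leq_maxl.
      by move: x01; rewrite !in_itv/= => /andP[-> /ltW].
  apply: summable => n; apply: le_trans (hU n).2.
  by rewrite leeDl// mule_ge0.
- rewrite setCK; apply: lim_sup_set_cvg0 => //; apply: summable => n.
  by apply: le_trans (hU n).2; rewrite mul1e leeDr.
Qed.

End singular.

(** * Restrictions of [takagi] to half periods, with a slope added *)

Section pieces.
Context (R : realType) (r : nat) (r1 : (1 < r)%N).
Local Notation mu := (@lebesgue_measure R).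
Local Notation MR := (measurableTypeR R).
Local Notation T := (@takagi R r).

(** The second summand is [T] on the half period [k/2, (k+1)/2], magnified by 2 in both directions.
    Its first term has slope 1 in [v] for even [k] and -1 for odd [k]. *)
Definition piece (h : int) (k : nat) (v : MR) : MR :=
  h%:~R * v + 2 * T ((k%:R + v) / 2).

Let r_gt0 : 0 < r%:R :> R. Proof. by rewrite ltr0n ltnW. Qed.
Let r_neq0 : r%:R != 0 :> R. Proof. by rewrite gt_eqF. Qed.

Lemma measurable_piece h k : measurable_fun setT (piece h k).
Proof.
apply: measurable_funD; apply: measurable_funM => //.
apply: (measurableT_comp (measurable_takagi r1)).
by apply: measurable_funM => //; exact: measurable_funD.
Qed.

Lemma piece_odd h k : piece h k = piece h (odd k).
Proof.
apply/funext => v; rewrite /piece -[in LHS](odd_double_half k).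
rewrite -(takagiDz r (((odd k)%:R + v) / 2) k./2) natrD -muln2 natrM.
by congr (_ + 2 * T _); field.
Qed.

(** The rising term of the series adds 1 to the slope; multiplying the argument by [r] turns the
    i-th subinterval into the i-th half period. *)
Lemma piece_rec0 h i (v : R) : (i < r)%N -> 0 <= v <= 1 ->
  piece h 0 ((i%:R + v) / r%:R) =
  (h + 1)%:~R * i%:R / r%:R + r%:R^-1 * piece (h + 1) i v.
Proof.
move=> ir /andP[v0 v1].
have iS : i%:R + 1 <= r%:R :> R by rewrite natr1 ler_nat.
have i0 : 0 <= i%:R :> R by [].
rewrite /piece takagi_rec// add0r dist_int_id; last first.
  apply/andP; split; first by rewrite !divr_ge0// addr_ge0.
  by rewrite -[leRHS]mul1r ler_pM2r// ler_pdivrMr//; lra.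
rewrite (_ : r%:R * _ = (i%:R + v) / 2); last by field.
by rewrite intrD; field.
Qed.

Lemma piece_rec1 h i (v : R) : (i < r)%N -> 0 <= v <= 1 ->
  piece h 1 ((i%:R + v) / r%:R) =
  (1 + (h - 1)%:~R * i%:R / r%:R) + r%:R^-1 * piece (h - 1) (r + i) v.
Proof.
move=> ir /andP[v0 v1].
have iS : i%:R + 1 <= r%:R :> R by rewrite natr1 ler_nat.
have i0 : 0 <= i%:R :> R by [].
(* The argument x lies in [1/2, 1], so its distance to the integers is that of 1 - x, which is in
   [0, 1/2]. *)
rewrite /piece takagi_rec// -dist_intN -(dist_intDz _ 1) dist_int_id; last first.
  have t0 : 0 <= (i%:R + v) / r%:R by rewrite !divr_ge0// addr_ge0.
  have t1 : (i%:R + v) / r%:R <= 1 by rewrite ler_pdivrMr//; lra.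
  by apply/andP; split; lra.
rewrite (_ : r%:R * _ = ((r + i)%:R + v) / 2); last by rewrite natrD; field.
by rewrite intrB; field.
Qed.

Lemma sum_odd (F : bool -> R) n :
  \sum_(i < n) F (odd i) = (uphalf n)%:R * F false + (n./2)%:R * F true.
Proof.
elim: n => [|n IH]; first by rewrite big_ord0 !mul0r addr0.
rewrite big_ord_recr/= IH uphalf_half.
by case: (odd n); rewrite ?add0n ?add1n -?natr1; ring.
Qed.

(** The numbers [n + i] and [n - 1 - i] have opposite parities, so reversing the sum gives [sum_odd]
    with the two values exchanged. *)
Lemma sum_odd_addl (F : bool -> R) n :
  \sum_(i < n) F (odd (n + i)) = (n./2)%:R * F false + (uphalf n)%:R * F true.
Proof.
rewrite addrC -(sum_odd (F \o negb)) (reindex_inj rev_ord_inj)/=.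
apply: eq_bigr => i _; rewrite oddD oddB//=.
by rewrite addbA addbb.
Qed.

Let mean2E (u d x y : R) :
  r%:R^-1 * (u * x + d * y) = u / r%:R * x + d / r%:R * y.
Proof. by field. Qed.

(** * Comparing the costs of the pieces *)

Section weight.
Variables (w : R) (w0 : 0 <= w).

Lemma cost_piece0_le h : cost w (piece h 0) <=
  (uphalf r)%:R / r%:R * cost w (piece (h + 1) 0) +
  (r./2)%:R / r%:R * cost w (piece (h + 1) 1).
Proof.
have r0 : (0 < r)%N by exact: ltnW.
have := cost_pieces r0 (measurable_piece h 0) (measurable_piece (h + 1))
  (@piece_rec0 h) w0.
under eq_bigr do rewrite piece_odd.
rewrite (sum_odd (fun b : bool => cost w (piece (h + 1) b)))/=.
by rewrite mean2E.
Qed.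

Lemma cost_piece1_le h : cost w (piece h 1) <=
  (r./2)%:R / r%:R * cost w (piece (h - 1) 0) +
  (uphalf r)%:R / r%:R * cost w (piece (h - 1) 1).
Proof.
have r0 : (0 < r)%N by exact: ltnW.
have := cost_pieces r0 (measurable_piece h 1)
  (fun i => measurable_piece (h - 1) (r + i)) (@piece_rec1 h) w0.
under eq_bigr do rewrite piece_odd.
rewrite (sum_odd_addl (fun b : bool => cost w (piece (h - 1) b)))/=.
by rewrite mean2E.
Qed.

(** The parity is the direction of the walk, kept with probability [uphalf r / r]. Since [r >= 2],
    turning has positive probability too. *)
Lemma cost_piece_cst h : cost w (piece h 0) = cost w (piece 0 0) /\
  cost w (piece h 1) = cost w (piece 0 0).
Proof.
have c1 h' k : `|cost w (piece h' k)| <= 1.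
  by rewrite ger0_norm ?cost_ge0// cost_le1.
apply: (bounded_subharmonic (a := (uphalf r)%:R / r%:R)
  (b := (r./2)%:R / r%:R) _ _ _ (A := fun h => cost w (piece h 0))
  (B := fun h => cost w (piece h 1))) => //.
- by rewrite divr_gt0// ltr0n uphalf_gt0 ltnW.
- by rewrite divr_gt0// ltr0n half_gt0.
- rewrite -mulrDl -natrD uphalf_half -addnA addnn odd_double_half divff//.
- exact: cost_piece0_le.
- exact: cost_piece1_le.
Qed.

(** As T(1 - x) = T(x), [piece 0 1] is [piece 0 0] reflected by v |-> 1 - v, here a translation
    followed by a change of sign. *)
Lemma missed_piece0_odd (b : bool) (V : set MR) : measurable V ->
  mu (missed (piece 0 b) V) = mu (missed (piece 0 0) V).
Proof.
move=> mV; case: b; last by [].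
pose P : set MR := (fun x : R => 1 * x + 1) @^-1` missed (piece 0 0) V.
have mM : measurable (missed (piece 0 0) V).
  by apply: measurable_missed => //; exact: measurable_piece.
have mP : measurable P by exact: measurable_affine_preimage.
have := lebesgue_measure_affine 1 ltr01 mM; rewrite invr1 mul1e => <-.
rewrite -(lebesgue_measureN mP); congr (mu _); apply/seteqP.
suff H (x : R) : missed (piece 0 1) V x <-> missed (piece 0 0) V (1 * (- x) + 1).
  by split => x /H.
rewrite /missed /= !in_itv/= (_ : piece 0 0 (1 * - x + 1) = piece 0 1 x).
  by split => -[/andP[? ?] ?]; split => //; apply/andP; split; lra.
rewrite /piece !mul0r !add0r -takagiN -[in RHS](takagiDz _ _ (-1)).
by congr (2 * T _); field.
Qed.

(** The slope 1 - 1 vanishes, so the offsets of the [r] subintervals all equal 1 and the single set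
    [U = 1 + V / r] serves all of them. Its measure is [mu V / r], which turns the weight [w] into
    [w / r]. *)
Lemma cost_piece11_le : cost w (piece 1 1) <= cost (w / r%:R) (piece 0 0).
Proof.
have wr0 : 0 <= w / r%:R by rewrite divr_ge0.
apply/ler_addgt0Pr => e e0; have [V mV cV] := costP (piece 0 0) wr0 e0.
apply: cost_le => //.
pose U : set MR := (fun y : R => r%:R * y + - r%:R) @^-1` V.
have mU : measurable U by exact: measurable_affine_preimage.
exists U => //; apply: le_trans cV; rewrite leeD//.
  have := @missed_pieces _ _ _ _ _ (ltnW r1) (measurable_piece 1 1)
    (fun i => measurable_piece 0 (r + i)) (@piece_rec1 1) U (fun=> V) mU
    (fun=> mV).
  rewrite (eq_bigr (fun=> mu (missed (piece 0 0) V))); last first.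
    by move=> i _; rewrite piece_odd missed_piece0_odd.
  move=> H; apply: le_trans (H _) _.
    move=> i y _ Vy.
    suff E : r%:R * (1 + (1 - 1)%:~R * i%:R / r%:R + r%:R^-1 * y) + - r%:R = y.
      by rewrite /U/= E.
    by rewrite subrr; field.
  by rewrite mean_cst// ltnW.
by rewrite lebesgue_measure_affine// muleA -EFinM.
Qed.

End weight.

Lemma cost_piece00_le w : 0 <= w -> cost w (piece 0 0) <= 4 * w.
Proof.
move=> w0; apply: cost_le => //; exists `[0, 4]%classic.
  exact: measurable_itv.
(* Since 0 <= T <= 2, the values of [piece 0 0] all lie in [0, 4]. *)
rewrite (_ : missed _ _ = set0) ?measure0 ?add0e.
  by rewrite lebesgue_measure_itv/= lte_fin ltr0n/= oppr0 adde0 -EFinM mulrC.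
apply/seteqP; split => // x [_ /=]; apply.
rewrite in_itv/= /piece mul0r add0r.
have := takagi_ge0 r1 ((0 + x) / 2); have := takagi_le2 r1 ((0 + x) / 2).
by move=> *; apply/andP; split; lra.
Qed.

Lemma cost_piece00 w : 0 <= w -> cost w (piece 0 0) = 0.
Proof.
move=> w0; set c := cost _ _.
have c_le n : c <= cost (w / r%:R ^+ n) (piece 0 0).
  elim: n => [|n IH]; first by rewrite expr0 divr1.
  have wn : 0 <= w / r%:R ^+ n by rewrite divr_ge0// exprn_ge0.
  (* Constancy of the cost replaces [piece 0 0] by [piece 1 1], where the weight can be divided by
     [r]. *)
  rewrite (le_trans IH)// -(cost_piece_cst wn 1).2.
  by rewrite (le_trans (cost_piece11_le wn))// exprSr invfM mulrA.
apply/le_anti; rewrite cost_ge0// andbT leNgt; apply/negP => c0.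
(* If [c > 0], some [n] exceeds [4 w / c]; then [r^n > n] gives [4 w / r^n < c], a contradiction. *)
have wc : 0 <= 4 * w / c by rewrite divr_ge0 ?mulr_ge0// ltW.
have := archi_boundP wc; set n := Num.bound _ => cn.
have rn : n%:R < r%:R ^+ n :> R by rewrite -natrX ltr_nat ltn_expl.
have := lt_trans cn rn; rewrite ltr_pdivrMr// ltNge => /negP; apply.
rewrite -ler_pdivlMl ?exprn_gt0//.
rewrite (le_trans (c_le n))// (le_trans (cost_piece00_le _))//.
  by rewrite divr_ge0// exprn_ge0.
by rewrite mulrA mulrC.
Qed.

(** The two halves of the period are [piece 0 0] and [piece 0 1], scaled by 1/2. *)
Lemma cost_takagi w : 0 <= w -> cost w (T : MR -> MR) = 0.
Proof.
move=> w0; apply/le_anti; rewrite cost_ge0// andbT.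
have := @cost_pieces R 2 (fun=> 0) (T : MR -> MR) (piece 0) isT
  (measurable_takagi r1) (measurable_piece 0) _ w w0.
rewrite !big_ord_recl big_ord0/= (cost_piece_cst w0 0).2 !cost_piece00// => H.
apply: le_trans (H _) _; last by rewrite !addr0 mulr0.
by move=> i v _ _; rewrite /piece mul0r !add0r mulKf.
Qed.

End pieces.

Theorem corollary1p2 (R : realType) (r : nat) (hr : (2 <= r)%N) :
  mutually_singular (occupation_measure (@takagi R r)) (@lebesgue_measure R).
Proof.
by apply: cost0_singular (measurable_takagi hr) _; exact: cost_takagi.
Qed.
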